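(* Let $T\ge 2$ be an integer and let $\mu>0$, $\sigma>0$, $-\frac{1}{T-1}<\rho<1$ satisfy $\mu^2+\rho\sigma^2>0$. Let $$\mathrm{R}(\gamma)=\sup_{\mathbb P\in\mathcal P}\mathbb P\Big(\prod_{t=1}^T\tilde\xi_t\ge\gamma\Big),\qquad \mathrm{R}'(\gamma)=\sup_{\mathbb P\in\mathcal P'}\mathbb P\Big(\prod_{t=1}^T\tilde\xi_t\ge\gamma\Big),$$ with the ambiguity sets $\mathcal P$ and $\mathcal P'$ defined in the context. If $\mu>\sqrt{\frac{1-\rho}{T}}\,\sigma$, then $\mathrm{R}'(\gamma)=\mathrm{R}(\gamma)$ for all $\gamma\ge\overline\gamma$, where $\overline\gamma$ is given by $$\overline\gamma^{1/T}=\mu+\frac{1}{2ab}\left(1+\sqrt{4ab\sqrt{\frac{1-\rho}{T}}\,\sigma+1}\right)$$ with $a=\mu-\sqrt{\frac{1-\rho}{T}}\,\sigma$, $b=\frac{T}{\sigma^2\theta}$ and $\theta=1+(T-1)\rho$.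
   Context: Let $\boldsymbol\mu=\mu\boldsymbol 1\in\mathbb R^T$ and $\boldsymbol\Sigma=(1-\rho)\sigma^2\mathbb I+\rho\sigma^2\boldsymbol 1\boldsymbol 1^\intercal$, where $\mathbb I$ is the $T\times T$ identity matrix and $\boldsymbol 1$ the all-ones vector. $\mathcal P$ is the set of all Borel probability distributions $\mathbb P$ of a random vector $\tilde{\boldsymbol\xi}=(\tilde\xi_1,\dots,\tilde\xi_T)^\intercal$ supported on $\mathbb R^T_+$ with $\mathbb E_{\mathbb P}(\tilde{\boldsymbol\xi})=\boldsymbol\mu$ and $\mathbb E_{\mathbb P}(\tilde{\boldsymbol\xi}\tilde{\boldsymbol\xi}^\intercal)=\boldsymbol\Sigma+\boldsymbol\mu\boldsymbol\mu^\intercal$. $\mathcal P'$ is defined in the same way, except that the last condition is relaxed to $\mathbb E_{\mathbb P}(\tilde{\boldsymbol\xi}\tilde{\boldsymbol\xi}^\intercal)\preceq\boldsymbol\Sigma+\boldsymbol\mu\boldsymbol\mu^\intercal$, where $\boldsymbol A\preceq\boldsymbol B$ means that $\boldsymbol B-\boldsymbol A$ is positive semidefinite. *)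

(* Defs.v *)
From HB Require Import structures.
From mathcomp Require Import all_boot all_order all_algebra.
From mathcomp Require Import all_classical all_reals all_analysis.
Set Implicit Arguments.
Unset Strict Implicit.
Unset Printing Implicit Defensive.
Import Order.TTheory GRing.Theory Num.Theory.
Import numFieldNormedType.Exports.
Local Open Scope classical_set_scope.
Local Open Scope ring_scope.

(* A distribution of a random vector in R^T is a probability measure on
   [T.-tuple R]. The library equips it with the product of the Borel
   sigma-algebras, which on R^T is the Borel sigma-algebra. *)
Definition distribution_on (R : realType) (T : nat) : Type :=
  probability (T.-tuple (measurableTypeR R)) R.

Definition nonneg_orthant (R : realType) (T : nat) :
    set (T.-tuple (measurableTypeR R)) :=
  [set x | forall t : 'I_T, 0 <= (tnth x t : R)].
Arguments nonneg_orthant : clear implicits.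

Definition product_event (R : realType) (T : nat) (gamma : R) :
    set (T.-tuple (measurableTypeR R)) :=
  [set x | gamma <= \prod_(t < T) (tnth x t : R)].

(* On a probability space this also makes every coordinate integrable. *)
Definition square_integrable (R : realType) (T : nat)
    (P : distribution_on R T) : Prop :=
  forall s t : 'I_T,
    P.-integrable setT (fun x => ((tnth x s : R) * (tnth x t : R))%:E).

(* [fine] sends infinite expectations to 0, so the next two definitions are
   only meaningful together with [square_integrable]. *)
Definition mean_vector (R : realType) (T : nat)
    (P : distribution_on R T) : 'cV[R]_T :=
  \col_(t < T) fine ('E_P[fun x => (tnth x t : R)]).

Definition second_moment (R : realType) (T : nat)
    (P : distribution_on R T) : 'M[R]_T :=
  \matrix_(s < T, t < T) fine ('E_P[fun x => (tnth x s : R) * (tnth x t : R)]).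

Definition psdmx (R : realType) (T : nat) (A : 'M[R]_T) : Prop :=
  A^T = A /\ forall x : 'cV[R]_T, 0 <= (x^T *m A *m x) ord0 ord0.

Definition loewner_le (R : realType) (T : nat) (A B : 'M[R]_T) : Prop :=
  psdmx (B - A).

Definition mean_param (R : realType) (T : nat) (mu : R) : 'cV[R]_T :=
  mu *: const_mx 1.

Definition cov_param (R : realType) (T : nat) (sigma rho : R) : 'M[R]_T :=
  ((1 - rho) * sigma ^+ 2) *: 1%:M
  + (rho * sigma ^+ 2) *: ((const_mx 1 : 'cV[R]_T) *m (const_mx 1 : 'cV[R]_T)^T).

Definition second_moment_param (R : realType) (T : nat) (mu sigma rho : R) :
    'M[R]_T :=
  cov_param T sigma rho + mean_param T mu *m (mean_param T mu)^T.

Definition ambiguity_set (R : realType) (T : nat) (mu sigma rho : R) :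
    set (distribution_on R T) :=
  [set P : distribution_on R T |
    [/\ P (nonneg_orthant R T) = 1%E,
        square_integrable P,
        mean_vector P = mean_param T mu
      & second_moment P = second_moment_param T mu sigma rho]].

Definition relaxed_ambiguity_set (R : realType) (T : nat) (mu sigma rho : R) :
    set (distribution_on R T) :=
  [set P : distribution_on R T |
    [/\ P (nonneg_orthant R T) = 1%E,
        square_integrable P,
        mean_vector P = mean_param T mu
      & loewner_le (second_moment P)
                   (second_moment_param T mu sigma rho)]].

Arguments ambiguity_set {R} T mu sigma rho.
Arguments relaxed_ambiguity_set {R} T mu sigma rho.

Definition worst_case_prob (R : realType) (T : nat)
    (A : set (distribution_on R T)) (gamma : R) : \bar R :=
  ereal_sup [set (P : distribution_on R T) (product_event gamma) | P in A].

(* Main.v *)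
Require Import Defs.
From HB Require Import structures.
From mathcomp Require Import all_boot all_order all_algebra.
From mathcomp Require Import all_classical all_reals all_analysis.
From mathcomp Require Import measurable_realfun ring lra.
Import Order.TTheory GRing.Theory Num.Theory.
Import numFieldNormedType.Exports.
Local Open Scope classical_set_scope.
Local Open Scope ring_scope.

(* Let g = gamma^(1/T), d = g - mu, and let v = 1/b, the variance of the
   coordinate average under Sigma. By AM-GM the event implies that the average
   is at least g, so Cantelli's inequality bounds its probability by
   p = v / (v + d^2) over the relaxed set, which only caps that variance at v.
   The bound is attained with exact moments: put mass p on g1 and spread the
   remaining mass evenly over the T points y1 + c(e_i - 1/T), where
   y = mu - v/d. The e_i supply the covariance orthogonal to 1 when
   (1 - p) c^2 = T (1 - rho) sigma^2. These points are nonnegative as soon as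
   y >= s / sqrt(1 - p) with s = sqrt((1 - rho)/T) sigma, which follows from
   a b d^2 - d - s >= 0; gammabar corresponds to the positive root in d. *)

(** * Finitely supported probability measures *)

(** The measure is a finite sum of scaled Dirac masses. The integral formula holds for nonnegative
    functions termwise, which gives integrability through [|f|], then the general formula through
    the positive and negative parts. *)
Lemma finite_atoms (R : realType) (d : measure_display) (X : measurableType d)
    (n : nat) (w : nat -> {nonneg R}) (p : nat -> X) :
  \sum_(i < n) (w i)%:num = 1 ->
  exists P : probability X R,
    (forall A, P A = (\sum_(i < n) (w i)%:num * (p i \in A)%:R)%:E) /\
    (forall f : X -> R, measurable_fun setT f ->
      P.-integrable setT (EFin \o f) /\
      (\int[P]_x (f x)%:E = (\sum_(i < n) (w i)%:num * f (p i))%:E)%E).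
Proof.
move=> w1.
pose m : {measure set X -> \bar R} :=
  msum (fun i => mscale (w i) (dirac (p i)) : {measure set X -> \bar R}) n.
have mE A : m A = (\sum_(i < n) (w i)%:num * (p i \in A)%:R)%:E.
  by rewrite /m /msum -sumEFin; apply: eq_bigr => i _; rewrite /= /mscale /= diracE.
have m1 : m setT = 1%E.
  rewrite mE; congr (_%:E); rewrite -[RHS]w1; apply: eq_bigr => i _.
  by rewrite in_setT mulr1.
pose isP := Measure_isProbability.Build _ _ _ m m1.
pose P : probability X R := HB.pack (Measure.sort m) isP.
have ge0_int (f : X -> R) : measurable_fun setT f -> (forall x, 0 <= f x) ->
    (\int[m]_x (f x)%:E = (\sum_(i < n) (w i)%:num * f (p i))%:E)%E.
  move=> mf f0; have mf' : measurable_fun setT (EFin \o f) by apply/measurable_EFinP.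
  rewrite ge0_integral_measure_sum//; last by move=> x _; rewrite lee_fin.
  rewrite -sumEFin; apply: eq_bigr => i _.
  rewrite ge0_integral_mscale//; last by move=> x _; rewrite lee_fin.
  by rewrite integral_dirac// diracT mul1e.
exists P; split => // f mf.
have mf' : measurable_fun setT (EFin \o f) by apply/measurable_EFinP.
split.
  apply/integrableP; split => //=.
  rewrite (_ : (fun x => _) = (fun x => (`|f x|)%:E)) //.
  rewrite ge0_int ?ltry //; exact: measurableT_comp.
rewrite integralE.
have -> : (\int[P]_x (EFin \o f)^\+%E x = \int[m]_x (Num.max (f x) 0)%:E)%E.
  by apply: eq_integral => x _; rewrite funeposE EFin_max.
have -> : (\int[P]_x (EFin \o f)^\-%E x = \int[m]_x (Num.max (- f x) 0)%:E)%E.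
  by apply: eq_integral => x _; rewrite funenegE EFin_max.
rewrite !ge0_int.
- rewrite -EFinB -sumrB; congr (_%:E); apply: eq_bigr => i _.
  rewrite -mulrBr; congr (_ * _).
  by rewrite /Num.max; case: ifP; case: ifP; lra.
- by apply: measurable_maxr => //; exact: measurableT_comp.
- by move=> x; rewrite le_max lexx orbT.
- by apply: measurable_maxr.
- by move=> x; rewrite le_max lexx orbT.
Qed.

(** * Measurability, and moments of the coordinate sum *)

Lemma measurable_coord (R : realType) (T : nat) (t : 'I_T) :
  measurable_fun setT (fun x : T.-tuple (measurableTypeR R) => (tnth x t : R)).
Proof. exact: measurable_tnth. Qed.

Lemma measurable_nonneg_orthant (R : realType) (T : nat) :
  measurable (nonneg_orthant R T).
Proof.
have -> : nonneg_orthant R T =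
    \bigcap_(t in [set: 'I_T]) ((fun x => (tnth x t : R)) @^-1` `[0, +oo[).
  apply/seteqP; split => [x xO t _|x xO t] /=.
    by rewrite in_itv /= andbT; exact: xO.
  by have := xO t Logic.I; rewrite /= in_itv /= andbT.
apply: fin_bigcap_measurable => // t _; rewrite -[X in measurable X]setTI.
exact: (measurable_coord _).
Qed.

Lemma measurable_product_event (R : realType) (T : nat) (gamma : R) :
  measurable (product_event (T := T) gamma).
Proof.
have mprod : measurable_fun setT (fun x : T.-tuple (measurableTypeR R) =>
    \prod_(t < T) (tnth x t : R)).
  by apply: measurable_prod => t _; exact: measurable_coord.
have -> : product_event (T := T) gamma =
    (fun x => \prod_(t < T) (tnth x t : R)) @^-1` `[gamma, +oo[.
  by apply/seteqP; split => x /=; rewrite in_itv /= andbT.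
by rewrite -[X in measurable X]setTI; exact: mprod.
Qed.

(** Domination by [1 + y ^ 2], which is at least [|y|]. *)
Lemma integrable_coord (R : realType) (T : nat) (P : distribution_on R T)
    (t : 'I_T) : square_integrable P ->
  P.-integrable setT (fun x => (tnth x t : R)%:E).
Proof.
move=> sqP; apply: (@le_integrable _ _ _ P _ _ _
  (fun x => (1%:E + ((tnth x t : R) * (tnth x t : R))%:E)%E)) => //.
- by apply/measurable_EFinP; exact: measurable_coord.
- move=> x _; rewrite /= lee_fin.
  move: (tnth x t : R) => y; rewrite [leRHS]ger0_norm; last by nra.
  by rewrite ler_norml; apply/andP; split; nra.
- apply: integrableD => //.
  exact: (finite_measure_integrable_cst P 1).
Qed.

(** This is how the moment constraints enter Cantelli's bound. The square splits into a quadratic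
    part [q], a linear part [l] and a constant; integrability makes every moment finite, so [fine]
    loses nothing. *)
Lemma integral_square_sum (R : realType) (T : nat) (P : distribution_on R T)
    (s : R) : square_integrable P ->
  P.-integrable setT (fun x => ((\sum_(t < T) (tnth x t : R) - s) ^+ 2)%:E) /\
  (\int[P]_x (((\sum_(t < T) (tnth x t : R) - s) ^+ 2)%:E) =
   (\sum_(i < T) \sum_(j < T) second_moment P i j
    - s *+ 2 * \sum_(t < T) mean_vector P t ord0 + s ^+ 2)%:E)%E.
Proof.
move=> sqP.
have i1 t := @integrable_coord _ _ P t sqP.
pose q x := (\sum_(i < T) \sum_(j < T) ((tnth x i : R) * (tnth x j : R))%:E)%E.
pose l x := ((- (s *+ 2))%:E * \sum_(t < T) (tnth x t : R)%:E)%E.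
have iq : P.-integrable setT q.
  by apply: integrable_sum => // i _; apply: integrable_sum => // j _; exact: sqP.
have il : P.-integrable setT l.
  by apply: integrableZl => //; apply: integrable_sum => // t _; exact: i1.
have ic : P.-integrable setT (fun=> (s ^+ 2)%:E).
  exact: (finite_measure_integrable_cst P (s ^+ 2)).
have -> : (fun x => ((\sum_(t < T) (tnth x t : R) - s) ^+ 2)%:E) =
    (fun x : T.-tuple (measurableTypeR R) => (q x + (l x + (s ^+ 2)%:E))%E).
  apply/funext => x; rewrite /q /l.
  under [in RHS]eq_bigr do rewrite sumEFin.
  rewrite !sumEFin -EFinM -!EFinD; congr (_%:E).
  under [in RHS]eq_bigr do rewrite -mulr_sumr.
  rewrite -mulr_suml; move: (\sum_(t < T) _) => S; ring.
have ilc : P.-integrable setT (fun x => (l x + (s ^+ 2)%:E)%E).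
  exact: integrableD.
split; first exact: integrableD.
rewrite integralD// integralD// integralZl//; last first.
  by apply: integrable_sum => // t _; exact: i1.
rewrite /q integral_sum//; last first.
  by move=> i; apply: integrable_sum => // j _; exact: sqP.
rewrite integral_sum//.
under eq_bigr => i _ do rewrite integral_sum//.
have -> : (\sum_(i < T) \sum_(j < T)
     \int[P]_x ((tnth x i : R) * (tnth x j : R))%:E =
     (\sum_(i < T) \sum_(j < T) second_moment P i j)%:E)%E.
  rewrite -sumEFin; apply: eq_bigr => i _; rewrite -sumEFin.
  apply: eq_bigr => j _; rewrite /second_moment mxE expectation.unlock fineK//.
  exact: integrable_fin_num (sqP i j).
have -> : (\sum_(i < T) \int[P]_x (tnth x i : R)%:E =
     (\sum_(i < T) mean_vector P i ord0)%:E)%E.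
  rewrite -sumEFin; apply: eq_bigr => i _.
  rewrite /mean_vector mxE expectation.unlock fineK//.
  exact: integrable_fin_num (i1 i).
have -> : (\int[P]_x (s ^+ 2)%:E = (s ^+ 2)%:E)%E.
  have := integral_cst P measurableT (s ^+ 2)%:E.
  by rewrite [X in (_ * X)%E]probability_setT mule1.
by rewrite -EFinM -!EFinD; congr (_%:E); ring.
Qed.

(** * Upper bound over the relaxed set *)

(** The complement of the orthant is null. Events can thus be cut down to the orthant, where AM-GM
    applies. *)
Lemma prob_nonneg_le (R : realType) (T : nat) (P : distribution_on R T)
    (A : set (T.-tuple (measurableTypeR R))) :
  P (nonneg_orthant R T) = 1%E -> measurable A ->
  (P A <= P (A `&` nonneg_orthant R T))%E.
Proof.
move=> PO mA; have mO := measurable_nonneg_orthant R T.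
have mI := measurableI _ _ mA mO; have mC := measurableC mO.
have PC0 : P (~` nonneg_orthant R T) = 0%E by rewrite probability_setC// PO subee.
rewrite -(measureU0 mI mC PC0); apply: le_measure; rewrite ?inE//.
  exact: measurableU.
by move=> x Ax; have [xO|xO] := pselect (nonneg_orthant R T x); [left|right].
Qed.

Lemma product_event_sum_ge (R : realType) (T : nat) (g : R)
    (x : T.-tuple (measurableTypeR R)) : (0 < T)%N -> 0 <= g ->
  nonneg_orthant R T x -> product_event (g ^+ T) x ->
  T%:R * g <= \sum_(t < T) (tnth x t : R).
Proof.
move=> T0 g0 xO xA.
have := @leif_AGM R 'I_T predT (fun t => tnth x t : R) (fun t _ => xO t).
rewrite /= card_ord => /leifP /= AGM.
have {AGM} : \prod_(t < T) (tnth x t : R) <=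
    ((\sum_(t < T) (tnth x t : R)) / T%:R) ^+ T.
  by move: AGM; case: ifP => _ => [/eqP ->|/ltW].
move=> /(le_trans xA); rewrite ler_pXn2r ?nnegrE//; last first.
  by rewrite divr_ge0 ?ler0n// sumr_ge0// => t _; exact: xO.
by rewrite ler_pdivlMr ?ltr0n// mulrC.
Qed.

Lemma second_moment_paramE (R : realType) (T : nat) (mu sigma rho : R)
    (i j : 'I_T) :
  second_moment_param T mu sigma rho i j =
  (1 - rho) * sigma ^+ 2 * (i == j)%:R + (rho * sigma ^+ 2 + mu ^+ 2).
Proof.
rewrite /second_moment_param /cov_param /mean_param !mxE !big_ord1 !mxE.
by rewrite -mulr_natr; ring.
Qed.

(** The sum is the quadratic form at the all-ones vector; it turns the Loewner constraint into a cap
    on the second moment of the coordinate sum. *)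
Lemma sum_psdmx_ge0 (R : realType) (T : nat) (A : 'M[R]_T) :
  psdmx A -> 0 <= \sum_(i < T) \sum_(j < T) A i j.
Proof.
case=> _ /(_ (const_mx 1)); rewrite mxE.
under eq_bigr => j _ do rewrite !mxE mulr1.
rewrite exchange_big; congr (_ <= _); apply: eq_bigr => j _.
by apply: eq_bigr => i _; rewrite !mxE mul1r.
Qed.

Lemma sum_second_moment_param (R : realType) (T : nat) (mu sigma rho : R) :
  \sum_(i < T) \sum_(j < T) second_moment_param T mu sigma rho i j =
  T%:R * ((1 - rho) * sigma ^+ 2) + T%:R ^+ 2 * (rho * sigma ^+ 2 + mu ^+ 2).
Proof.
under eq_bigr => i _.
  under eq_bigr => j _ do rewrite second_moment_paramE.
  rewrite big_split/= (bigD1 i)//= eqxx big1 ?addr0; last first.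
    by move=> j /negPf; rewrite eq_sym => ->; rewrite mulr0.
  rewrite sumr_const card_ord mulr1.
  over.
rewrite sumr_const card_ord; ring.
Qed.

Lemma prob_product_event_le (R : realType) (T : nat) (mu sigma rho v d : R)
    (P : distribution_on R T) :
  (0 < T)%N -> 0 < d -> 0 <= mu + d -> 0 <= v ->
  v = rho * sigma ^+ 2 + (1 - rho) * sigma ^+ 2 / T%:R ->
  relaxed_ambiguity_set T mu sigma rho P ->
  (P (product_event ((mu + d) ^+ T)) <= (v / (v + d ^+ 2))%:E)%E.
Proof.
move=> T0 d0 g0 v0 vE [PO sqP meanP secP].
have TR0 : (0 : R) < T%:R by rewrite ltr0n.
(* Among parabolas in the average with a double zero [mu - u] and value 1 at [mu + d], the
   expectation [(v + u ^ 2) / (d + u) ^ 2] is least at [u = v / d]. *)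
pose s := T%:R * (mu - v / d).
pose r := T%:R * (mu + d) - s.
have r0 : 0 < r.
  rewrite /r /s -mulrBr mulr_gt0//; have : 0 <= v / d by rewrite divr_ge0// ltW.
  lra.
have [iQ intQ] := @integral_square_sum R T P s sqP.
set A := product_event _.
have mA : measurable A by exact: measurable_product_event.
apply: (le_trans (prob_nonneg_le _ _ _ _ PO mA)).
set B := A `&` _.
have mB : measurable B by apply: measurableI => //; exact: measurable_nonneg_orthant.
rewrite -[P B](_ : \int[P]_x (\1_B x)%:E = _)%E; last first.
  by rewrite integral_indic// setIT.
(* Cantelli's test function: the parabola vanishing at [s], equal to 1 at
   [T * (mu + d)]. *)
apply: (@le_trans _ _ (\int[P]_x
    ((r ^- 2)%:E * ((\sum_(t < T) (tnth x t : R) - s) ^+ 2)%:E))%E).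
  apply: le_integral => //.
  - exact: integrable_indic.
  - exact: integrableZl.
  - move=> x _; rewrite -EFinM lee_fin indicE.
    have [|_] := boolP (x \in B); last by rewrite mulr_ge0 ?sqr_ge0// invr_ge0 sqr_ge0.
    rewrite inE => -[xA xO].
    have sx := @product_event_sum_ge _ _ _ x T0 g0 xO xA.
    have rx : r <= \sum_(t < T) (tnth x t : R) - s by rewrite /r lerD2r.
    rewrite ler_pdivlMl ?exprn_gt0// mulr1 ler_pXn2r ?nnegrE ?(ltW r0)//.
    exact: le_trans (ltW r0) rx.
rewrite integralZl// intQ -EFinM lee_fin.
have meanE : \sum_(t < T) mean_vector P t ord0 = T%:R * mu.
  under eq_bigr => t _ do rewrite meanP /mean_param !mxE mulr1.
  by rewrite sumr_const card_ord mulr_natl.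
have secE : \sum_(i < T) \sum_(j < T) second_moment P i j <=
    T%:R ^+ 2 * (v + mu ^+ 2).
  have := @sum_psdmx_ge0 _ _ _ secP.
  have -> : \sum_(i < T) \sum_(j < T)
      (second_moment_param T mu sigma rho - second_moment P) i j =
      \sum_(i < T) \sum_(j < T) second_moment_param T mu sigma rho i j -
      \sum_(i < T) \sum_(j < T) second_moment P i j.
    rewrite -sumrB; apply: eq_bigr => i _; rewrite -sumrB.
    by apply: eq_bigr => j _; rewrite !mxE.
  rewrite sum_second_moment_param subr_ge0 => /le_trans; apply.
  rewrite le_eqVlt; apply/orP; left; apply/eqP; rewrite vE; field.
  by rewrite gt_eqF.
rewrite meanE.
rewrite -ler_pdivlMl ?invr_gt0 ?exprn_gt0// invrK.
(* Second moment about [s]: the variance cap [v] of the average plus its squared offset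
   [(v / d) ^ 2], scaled by [T ^ 2]. *)
apply: (@le_trans _ _ (T%:R ^+ 2 * (v + v ^+ 2 / d ^+ 2))).
  have -> : T%:R ^+ 2 * (v + v ^+ 2 / d ^+ 2) =
     T%:R ^+ 2 * (v + mu ^+ 2) - s *+ 2 * (T%:R * mu) + s ^+ 2.
    by rewrite /s; field; rewrite gt_eqF.
  by rewrite -!addrA lerD2r.
rewrite le_eqVlt; apply/orP; left; apply/eqP; rewrite /r /s; field.
have h : 0 < v + d ^+ 2 by rewrite ltr_wpDl// exprn_gt0.
by rewrite !gt_eqF.
Qed.

(** * A distribution with exact moments attaining the bound *)

(** The moment conditions decouple: [y] and [g] fix the mean and second moment of the coordinate
    average, while [c] fixes the spread orthogonal to the all-ones vector. The bound [c / T <= y]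
    keeps the atoms in the orthant. *)
Lemma atomic_attainment (R : realType) (T : nat) (mu sigma rho p y g c : R) :
  (0 < T)%N -> 0 <= p <= 1 -> 0 <= g -> 0 <= c -> c / T%:R <= y ->
  (1 - p) * y + p * g = mu ->
  (1 - p) * y ^+ 2 + p * g ^+ 2 =
    mu ^+ 2 + rho * sigma ^+ 2 + (1 - rho) * sigma ^+ 2 / T%:R ->
  (1 - p) * c ^+ 2 = T%:R * ((1 - rho) * sigma ^+ 2) ->
  exists2 P : distribution_on R T, ambiguity_set T mu sigma rho P &
    (p%:E <= P (product_event (g ^+ T)))%E.
Proof.
move=> T0 /andP[p0 p1] g0 c0 cy meanE secE cE.
have TR0 : (0 : R) < T%:R by rewrite ltr0n.
have TRn0 : (T%:R : R) != 0 by rewrite gt_eqF.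
have q0 : 0 <= (1 - p) / T%:R by rewrite divr_ge0 ?ler0n// subr_ge0.
(* Indices below [T] are the low atoms, sharing mass [1 - p] equally; the last index, [T], is the
   constant vector [g] with mass [p]. *)
pose w i : {nonneg R} := if (i < T)%N then NngNum q0 else NngNum p0.
pose u := y - c / T%:R.
have u0 : 0 <= u by rewrite subr_ge0.
pose x i : T.-tuple (measurableTypeR R) :=
  if (i < T)%N then [tuple u + c * (t == i :> nat)%:R | t < T] else [tuple g | t < T].
have sumE (F : T.-tuple (measurableTypeR R) -> R) :
    \sum_(i < T.+1) (w i)%:num * F (x i) =
    (1 - p) / T%:R * (\sum_(i < T) F [tuple u + c * (t == i)%:R | t < T])
      + p * F [tuple g | t < T].
  rewrite big_ord_recr/= /w /x ltnn/=; congr (_ + _).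
  by rewrite mulr_sumr; apply: eq_bigr => i _; rewrite /= ltn_ord.
have w1 : \sum_(i < T.+1) (w i)%:num = 1.
  under eq_bigr do rewrite -[_%:num]mulr1.
  by rewrite (sumE (fun=> 1)) sumr_const card_ord; field.
have [P [PE fE]] := @finite_atoms R _ _ T.+1 w x w1.
have sumd (t : 'I_T) : \sum_(i < T) (t == i)%:R = 1 :> R.
  rewrite (bigD1 t)//= eqxx big1 ?addr0// => i /negPf.
  by rewrite eq_sym => ->.
have sumdd (s t : 'I_T) : \sum_(i < T) ((s == i)%:R * (t == i)%:R) = (s == t)%:R :> R.
  rewrite (bigD1 t)//= eqxx mulr1 big1 ?addr0// => i /negPf.
  by rewrite eq_sym => ->; rewrite mulr0.
have mcoord (t : 'I_T) := @measurable_coord R T t.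
have mcoord2 (s t : 'I_T) : measurable_fun setT
    (fun z : T.-tuple (measurableTypeR R) => (tnth z s : R) * (tnth z t : R)).
  by apply: measurable_funM; exact: measurable_coord.
exists P.
  split.
  - rewrite PE; congr (_%:E); rewrite -[RHS]w1; apply: eq_bigr => i _.
    rewrite mem_set ?mulr1// => t; rewrite /x; case: ifP => _; rewrite tnth_mktuple//.
    by rewrite addr_ge0// mulr_ge0.
  - by move=> s t; have [] := fE _ (mcoord2 s t).
  - apply/matrixP => t j; rewrite /mean_vector /mean_param !mxE expectation.unlock.
    have [_ ->] := fE _ (mcoord t); rewrite (sumE (fun z => tnth z t : R)) tnth_mktuple.
    under eq_bigr do rewrite tnth_mktuple.
    rewrite big_split/= -mulr_sumr sumd sumr_const card_ord -meanE /u -mulr_natl.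
    by field.
  - apply/matrixP => s t; rewrite second_moment_paramE mxE expectation.unlock.
    have [_ ->] := fE _ (mcoord2 s t).
    rewrite (sumE (fun z => (tnth z s : R) * (tnth z t : R))) !tnth_mktuple.
    have -> : \sum_(i < T) ((tnth [tuple u + c * (t == i)%:R | t < T] s : R) *
        (tnth [tuple u + c * (t == i)%:R | t < T] t : R)) =
        \sum_(i < T) (u ^+ 2 + u * c * (s == i)%:R + u * c * (t == i)%:R
          + c ^+ 2 * ((s == i)%:R * (t == i)%:R)).
      by apply: eq_bigr => i _; rewrite !tnth_mktuple; ring.
    rewrite !big_split/= -!mulr_sumr !sumd sumdd sumr_const card_ord -mulr_natl.
    (* Eliminating [g ^ 2] and [(1 - rho) * sigma ^ 2] through the moment equations leaves a
       rational identity. *)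
    have -> : p * (g * g) = mu ^+ 2 + rho * sigma ^+ 2 +
        (1 - rho) * sigma ^+ 2 / T%:R - (1 - p) * y ^+ 2 by rewrite -secE; ring.
    have -> : (1 - rho) * sigma ^+ 2 = (1 - p) * c ^+ 2 / T%:R.
      by rewrite cE; field.
    by rewrite /u; field.
(* The atom at [g] alone gives [p]; the low atoms contribute a nonnegative remainder. *)
rewrite PE lee_fin big_ord_recr/= [in X in _ + X]/w ltnn /=.
rewrite mem_set ?mulr1; last first.
  rewrite /product_event /x ltnn /=.
  by under eq_bigr do rewrite tnth_mktuple; rewrite prodr_const card_ord.
by rewrite lerDr sumr_ge0// => i _; rewrite mulr_ge0.
Qed.

(** * Inclusion of the sets, the threshold, and the equality *)

Lemma ambiguity_set_sub (R : realType) (T : nat) (mu sigma rho : R) :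
  ambiguity_set T mu sigma rho `<=` relaxed_ambiguity_set T mu sigma rho.
Proof.
move=> P [PO sqP meanP secP]; split => //; rewrite /loewner_le secP subrr.
by split=> [|x]; rewrite ?trmx0// mulmx0 mul0mx mxE.
Qed.

(* The right-hand side is the positive root of [k * t ^ 2 - t - s]. *)
Lemma quadratic_ge0 (R : rcfType) (k s d : R) : 0 < k -> 0 <= s ->
  (2 * k)^-1 * (1 + Num.sqrt (4 * k * s + 1)) <= d -> 0 <= k * d ^+ 2 - d - s.
Proof.
move=> k0 s0; set q := Num.sqrt _; set D := _ * _ => Dd.
have q0 : 0 <= q by exact: sqrtr_ge0.
have q2 : q ^+ 2 = 4 * k * s + 1.
  by rewrite sqr_sqrtr// addr_ge0// !mulr_ge0// ltW.
have kD : k * D = (1 + q) / 2 by rewrite /D; field; rewrite gt_eqF.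
have kd : k * D <= k * d by rewrite ler_pM2l.
have DE : k * D ^+ 2 - D - s = 0.
  have -> : s = (q ^+ 2 - 1) / (4 * k) by rewrite q2; field; rewrite gt_eqF.
  by rewrite /D; field; rewrite gt_eqF.
(* Expansion around the root [D]: the last factor is at least [2 * k * D - 1 = q], hence
   nonnegative. *)
have -> : k * d ^+ 2 - d - s =
    (k * D ^+ 2 - D - s) + (d - D) * (k * d + k * D - 1) by ring.
by rewrite DE add0r mulr_ge0//; lra.
Qed.

Theorem proposition5p1 (R : realType) (T : nat) (mu sigma rho : R)
    (hT : (2 <= T)%N) (hmu : 0 < mu) (hsigma : 0 < sigma)
    (hrho_gt : - (T%:R - 1)^-1 < rho) (hrho_lt : rho < 1)
    (hcross : 0 < mu ^+ 2 + rho * sigma ^+ 2)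
    (hmu_gt : Num.sqrt ((1 - rho) / T%:R) * sigma < mu)
    (theta a b gammabar : R)
    (htheta : theta = 1 + (T%:R - 1) * rho)
    (ha : a = mu - Num.sqrt ((1 - rho) / T%:R) * sigma)
    (hb : b = T%:R / (sigma ^+ 2 * theta))
    (hgammabar_ge0 : 0 <= gammabar)
    (hgammabar : gammabar `^ (T%:R^-1) =
       mu + (2 * a * b)^-1 *
         (1 + Num.sqrt (4 * a * b * Num.sqrt ((1 - rho) / T%:R) * sigma + 1))) :
  forall gamma : R, gammabar <= gamma ->
    worst_case_prob (relaxed_ambiguity_set T mu sigma rho) gamma =
    worst_case_prob (ambiguity_set T mu sigma rho) gamma.
Proof.
move=> gamma gamma_ge.
have T0 : (0 < T)%N by exact: leq_trans hT.
set N : R := T%:R in hrho_gt hmu_gt htheta ha hb hgammabar *.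
have N2 : 2 <= N by rewrite ler_nat.
have N0 : 0 < N by lra.
set s0 := Num.sqrt _ in hmu_gt ha hgammabar.
have s00 : 0 <= s0 by exact: sqrtr_ge0.
have s02 : s0 ^+ 2 = (1 - rho) / N.
  by rewrite sqr_sqrtr// divr_ge0 ?(ltW N0)// subr_ge0 ltW.
pose s := s0 * sigma.
have s_ge0 : 0 <= s by rewrite mulr_ge0// ltW.
(* [sigma ^ 2 * theta] is the eigenvalue of the covariance matrix on the all-ones vector; the lower
   bound on [rho] makes it positive. *)
have theta0 : 0 < theta.
  have : (N - 1) * (- (N - 1)^-1) < (N - 1) * rho by rewrite ltr_pM2l//; lra.
  rewrite mulrN mulfV; last by rewrite gt_eqF//; lra.
  by rewrite htheta; lra.
pose v := sigma ^+ 2 * theta / N.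
have v0 : 0 < v by rewrite divr_gt0// mulr_gt0// exprn_gt0.
have vE : v = rho * sigma ^+ 2 + (1 - rho) * sigma ^+ 2 / N.
  by rewrite /v htheta; field; rewrite gt_eqF.
have bE : b = v^-1 by rewrite hb /v; field; rewrite !gt_eqF.
have a0 : 0 < a by rewrite ha subr_gt0.
have b0 : 0 < b by rewrite bE invr_gt0.
pose g := gamma `^ N^-1.
have gamma0 : 0 <= gamma by exact: le_trans gamma_ge.
have g0 : 0 <= g by exact: powR_ge0.
have gT : g ^+ T = gamma.
  by rewrite -powR_mulrn// -powRrM mulVf ?gt_eqF// powRr1.
have Gg : gammabar `^ N^-1 <= g.
  by apply: ge0_ler_powR; rewrite ?nnegrE// invr_ge0 ltW.
pose d := g - mu.
have gE : g = mu + d by rewrite /d addrC subrK.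
have ab0 : 0 < a * b by rewrite mulr_gt0.
(* The threshold on [gamma] says that [d] is at least the positive root of
   [a * b * t ^ 2 - t - s]. *)
have dD : (2 * (a * b))^-1 * (1 + Num.sqrt (4 * (a * b) * s + 1)) <= d.
  by rewrite /s /d mulrA [4 * _]mulrA [_ * (_ * sigma)]mulrA lerBrDl -hgammabar.
have d0 : 0 < d.
  apply: lt_le_trans dD; apply: mulr_gt0; last exact: ltr_pwDl.
  by rewrite invr_gt0 mulr_gt0.
have quad := quadratic_ge0 _ _ _ _ ab0 s_ge0 dD.
have vd0 : 0 < v + d ^+ 2 by rewrite addr_gt0// exprn_gt0.
pose p := v / (v + d ^+ 2).
pose y := mu - v / d.
(* Solves [(1 - p) * c ^ 2 = T * (1 - rho) * sigma ^ 2], as [1 - p = d ^ 2 / (v + d ^ 2)]. *)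
pose c2 := N * ((1 - rho) * sigma ^+ 2) * ((v + d ^+ 2) / d ^+ 2).
pose c := Num.sqrt c2.
have c20 : 0 <= c2.
  apply: mulr_ge0; last by rewrite divr_ge0 ?sqr_ge0// ltW.
  by rewrite mulr_ge0 ?(ltW N0)// mulr_ge0 ?sqr_ge0// subr_ge0 ltW.
have c0 : 0 <= c by exact: sqrtr_ge0.
have cE : c ^+ 2 = c2 by rewrite sqr_sqrtr.
(* With [Z = (v + d ^ 2) / d ^ 2 = 1 / (1 - p)], nonnegativity of the atoms asks for
   [y >= s * sqrt Z]. The quadratic gives the stronger [y >= s * Z], because [Z >= 1]. *)
have yZ : s * ((v + d ^+ 2) / d ^+ 2) <= y.
  rewrite -subr_ge0.
  have -> : y - s * ((v + d ^+ 2) / d ^+ 2) =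
      v / d ^+ 2 * (a * b * d ^+ 2 - d - s).
    by rewrite /y bE ha -/s; field; rewrite !gt_eqF.
  by rewrite mulr_ge0// divr_ge0 ?sqr_ge0// ltW.
have Z1 : 1 <= (v + d ^+ 2) / d ^+ 2.
  by rewrite ler_pdivlMr ?exprn_gt0// mul1r lerDr ltW.
have y0 : 0 <= y by apply: le_trans yZ; rewrite mulr_ge0// (le_trans ler01).
have cy : c / N <= y.
  rewrite ler_pdivrMr// -(@ler_pXn2r _ 2) ?nnegrE ?mulr_ge0 ?(ltW N0)// cE.
  apply: (@le_trans _ _ ((s * ((v + d ^+ 2) / d ^+ 2)) ^+ 2 * N ^+ 2)).
    (* Here [c2 = (s * N) ^ 2 * Z], and [Z <= Z ^ 2]. *)
    have -> : c2 = s ^+ 2 * N ^+ 2 * ((v + d ^+ 2) / d ^+ 2).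
      rewrite /c2 /s [(s0 * _) ^+ 2]exprMn s02; field.
      by rewrite !gt_eqF.
    rewrite [(s * _) ^+ 2]exprMn [leRHS]mulrAC; apply: ler_wpM2l.
      by rewrite mulr_ge0// sqr_ge0.
    by rewrite expr2 ler_peMr// (le_trans ler01).
  rewrite [(y * _) ^+ 2]exprMn ler_pM2r ?exprn_gt0// ler_pXn2r ?nnegrE//.
  by rewrite mulr_ge0// (le_trans ler01).
have p01 : 0 <= p <= 1.
  rewrite /p divr_ge0 ?(ltW v0) ?(ltW vd0)//= ler_pdivrMr// mul1r.
  by rewrite lerDl sqr_ge0.
have [P PA Pp] : exists2 P : distribution_on R T, ambiguity_set T mu sigma rho P &
    (p%:E <= P (product_event (g ^+ T)))%E.
  apply: (@atomic_attainment R T mu sigma rho p y g c) => //.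
  - by rewrite gE /p /y; field; rewrite !gt_eqF.
  - rewrite -addrA -vE gE /p /y; field; rewrite !gt_eqF//.
  - by rewrite cE /c2 /p; field; rewrite !gt_eqF.
(* The relaxed supremum is at most [p], which [P] reaches inside the exact set; the converse is
   inclusion of the sets. *)
apply/eqP; rewrite eq_le; apply/andP; split.
  apply: (@le_trans _ _ p%:E).
    apply: ge_ereal_sup => _ [Q QA <-]; rewrite -gT gE.
    apply: prob_product_event_le QA => //; first by rewrite -gE.
    exact: ltW.
  rewrite -gT; apply: (le_trans Pp); apply: ereal_sup_ubound.
  by exists P.
by apply: ereal_sup_le; apply: image_subset; exact: ambiguity_set_sub.
Qed.
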